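(* Let $Q$ be a strongly locally finite quiver and $k$ a field. If $0\to L\to M\to N\to0$ is a short exact sequence in $\mathrm{rep}(Q)$, then it is an almost split sequence in $\mathrm{rep}^+(Q)$ if and only if it is an almost split sequence in $\mathrm{rep}(Q)$ with $L\in\mathrm{rep}^b(Q)$.
   Context: A quiver $Q=(Q_0,Q_1)$ is locally finite if every vertex is the starting point of finitely many arrows and the ending point of finitely many arrows; interval-finite if for all $x,y\in Q_0$ the set $Q(x,y)$ of paths from $x$ to $y$ (including trivial paths) is finite; strongly locally finite if both. $\mathrm{rep}(Q)$ is the abelian category of locally finite dimensional $k$-representations $M$ of $Q$ (each $M(x)$ finite dimensional), and $\mathrm{rep}^b(Q)$ its full subcategory of finite dimensional representations ($\sum_x\dim M(x)<\infty$). For $a\in Q_0$, $P_a$ is the representation with $P_a(x)$ the $k$-space with basis $Q(a,x)$, an arrow $\alpha$ acting by $\rho\mapsto\alpha\rho$. $\mathrm{rep}^+(Q)$ is the full subcategory of $\mathrm{rep}(Q)$ of finitely presented representations: those $M$ with an exact sequence $0\to P_1\to P_0\to M\to0$ where $P_0,P_1$ are finite direct sums of representations $P_a$. It is an abelian category, closed under extensions in $\mathrm{rep}(Q)$ and containing $\mathrm{rep}^b(Q)$. A morphism $f:X\to Y$ in an additive category is right minimal if every $h:X\to X$ with $fh=f$ is an automorphism; right almost split if $f$ is not a retraction and every non-retraction $g:Z\to Y$ factors through $f$; minimal right almost split if both. Left minimal, left almost split and minimal left almost split are the dual notions. An almost split sequence in an abelian category is a short exact sequence $0\to X\xrightarrow{f}Y\xrightarrow{g}Z\to0$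 in that category with $f$ minimal left almost split and $g$ minimal right almost split. *)

(* Defs.v *)
From HB Require Import structures.
From mathcomp Require Import all_boot all_algebra.
From mathcomp Require Import finmap boolp classical_sets cardinality.

Set Implicit Arguments.
Unset Strict Implicit.
Unset Printing Implicit Defensive.

Import GRing.Theory.
Local Open Scope ring_scope.
Local Open Scope classical_set_scope.

Record quiver := Quiver {
  vertex : Type;
  arrow : vertex -> vertex -> Type }.

(* [qpath x y] is the type of paths from x to y; [qrcons p al] is the path
   written (al p) in the usual right-to-left notation. *)
Inductive qpath (Q : quiver) (x : vertex Q) : vertex Q -> Type :=
| qnil : qpath x x
| qrcons y z : qpath x y -> arrow y z -> qpath x z.
Arguments qnil {Q} x.

Definition locally_finite (Q : quiver) := forall x : vertex Q,
  finite_set [set: {y & arrow x y}] /\ finite_set [set: {y & arrow y x}].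

Definition interval_finite (Q : quiver) := forall x y : vertex Q,
  finite_set [set: qpath x y].

Definition strongly_locally_finite (Q : quiver) :=
  locally_finite Q /\ interval_finite Q.

(* Objects of rep(Q): since a [vectType] is finite dimensional, these are
   exactly the locally finite dimensional representations. *)
Record rep (k : fieldType) (Q : quiver) := Rep {
  rep_at :> vertex Q -> vectType k;
  rep_act : forall x y, arrow x y -> 'Hom(rep_at x, rep_at y) }.

Record rep_hom (k : fieldType) (Q : quiver) (M N : rep k Q) := RepHom {
  hom_at :> forall x, 'Hom(M x, N x);
  hom_nat : forall x y (al : arrow x y),
    (hom_at y \o rep_act M al = rep_act N al \o hom_at x)%VF }.

Section Category.
Variables (k : fieldType) (Q : quiver).
Implicit Types L M N X Y Z : rep k Q.

Lemma hom_id_nat M x y (al : arrow x y) :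
  (\1 \o rep_act M al = rep_act M al \o \1)%VF.
Proof. by rewrite comp_lfun1l comp_lfun1r. Qed.

Definition hom_id M : rep_hom M M := RepHom (@hom_id_nat M).

Lemma hom_comp_nat L M N (g : rep_hom M N) (f : rep_hom L M)
    x y (al : arrow x y) :
  ((g y \o f y) \o rep_act L al = rep_act N al \o (g x \o f x))%VF.
Proof. by rewrite -comp_lfunA hom_nat comp_lfunA hom_nat comp_lfunA. Qed.

Definition hom_comp L M N (g : rep_hom M N) (f : rep_hom L M) : rep_hom L N :=
  RepHom (hom_comp_nat g f).

Definition automorphism X (h : rep_hom X X) :=
  exists h', hom_comp h h' = hom_id X /\ hom_comp h' h = hom_id X.

Definition retraction X Y (f : rep_hom X Y) :=
  exists s : rep_hom Y X, hom_comp f s = hom_id Y.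

Definition section X Y (f : rep_hom X Y) :=
  exists r : rep_hom Y X, hom_comp r f = hom_id X.

Definition right_minimal X Y (f : rep_hom X Y) :=
  forall h : rep_hom X X, hom_comp f h = f -> automorphism h.

Definition left_minimal X Y (f : rep_hom X Y) :=
  forall h : rep_hom Y Y, hom_comp h f = f -> automorphism h.

(* In what follows C stands for a full subcategory of rep(Q), given by its
   class of objects. *)
Definition right_almost_split (C : rep k Q -> Prop) X Y (f : rep_hom X Y) :=
  ~ retraction f /\
  forall Z (g : rep_hom Z Y), C Z -> ~ retraction g ->
    exists h : rep_hom Z X, hom_comp f h = g.

Definition left_almost_split (C : rep k Q -> Prop) X Y (f : rep_hom X Y) :=
  ~ section f /\
  forall Z (g : rep_hom X Z), C Z -> ~ section g ->
    exists h : rep_hom Y Z, hom_comp h f = g.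

Definition min_right_almost_split (C : rep k Q -> Prop) X Y (f : rep_hom X Y) :=
  right_minimal f /\ right_almost_split C f.

Definition min_left_almost_split (C : rep k Q -> Prop) X Y (f : rep_hom X Y) :=
  left_minimal f /\ left_almost_split C f.

(* Kernels, images and cokernels in rep(Q) are computed at each vertex. *)
Definition short_exact L M N (f : rep_hom L M) (g : rep_hom M N) :=
  forall x, [/\ lker (f x) = 0%VS, limg (f x) = lker (g x)
              & limg (g x) = fullv].

(* C is meant to be an abelian subcategory closed under kernels and cokernels
   in rep(Q), as rep(Q) and rep^+(Q) are, so that a sequence in C is exact in C
   if and only if it is exact in rep(Q). *)
Definition almost_split_sequence (C : rep k Q -> Prop) L M N
    (f : rep_hom L M) (g : rep_hom M N) :=
  [/\ C L, C M & C N] /\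
  [/\ short_exact f g, min_left_almost_split C f
    & min_right_almost_split C g].

(* The whole category rep(Q). *)
Definition rep_all : rep k Q -> Prop := fun=> True.

(* The sum of dim M(x) over the possibly infinite set of vertices is finite:
   its finite partial sums are bounded. *)
Definition rep_b : rep k Q -> Prop := fun M =>
  exists n : nat, forall s : seq {classic vertex Q}, uniq s ->
    (\sum_(x <- s) \dim {: M x} <= n)%N.

Definition rep0 : rep k Q :=
  @Rep k Q (fun=> 'rV[k]_0 : vectType k) (fun _ _ _ => 0).

Definition sum_fun M N x y (al : arrow x y) (u : M x * N x) : M y * N y :=
  (rep_act M al u.1, rep_act N al u.2).

Definition rep_sum M N : rep k Q :=
  @Rep k Q (fun x => (M x * N x)%type : vectType k)
    (fun x y al => linfun (sum_fun (M := M) (N := N) al)).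

Lemma sum_fun_linear M N x y (al : arrow x y) :
  linear (sum_fun (M := M) (N := N) al).
Proof.
by move=> c [u1 u2] [v1 v2]; rewrite /sum_fun /= !linearP.
Qed.

Lemma rep_sumE M N x y (al : arrow x y) (u : M x * N x) :
  rep_act (rep_sum M N) al u = (rep_act M al u.1, rep_act N al u.2).
Proof.
pose lin := GRing.isLinear.Build k _ _ _ _ (@sum_fun_linear M N x y al).
pose F : {linear (M x * N x)%type -> (M y * N y)%type} :=
  HB.pack (sum_fun (M := M) (N := N) al) lin.
exact: (lfunE F).
Qed.

End Category.
Arguments rep_b {k Q}.
Arguments rep_all {k Q}.

Section Projective.
Variables (k : fieldType) (Q : quiver) (fQ : interval_finite Q).

Lemma qpath_enumP (x y : vertex Q) :
  Finite.axiom (enum_fset (fset_set [set: {classic qpath x y}])).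
Proof.
apply: Finite.uniq_enumP; first exact: fset_uniq.
by move=> p; rewrite (@in_fset_set {classic qpath x y} _ (fQ x y)) in_setT.
Qed.

Definition qpath_fin (x y : vertex Q) : finType := fin_type (@qpath_enumP x y).

(* k^Q(a,x), with basis the indicator functions [proj_basis p], p in Q(a,x). *)
Definition proj_space (a x : vertex Q) : vectType k :=
  {ffun qpath_fin a x -> k^o}.

Definition proj_basis a x (p : qpath_fin a x) : proj_space a x :=
  [ffun q => (q == p)%:R].

Definition proj_fun a x y (al : arrow x y) (u : proj_space a x) :
    proj_space a y :=
  \sum_p u p *: proj_basis (qrcons p al : qpath_fin a y).

Definition proj (a : vertex Q) : rep k Q :=
  @Rep k Q (proj_space a) (fun x y al => linfun (@proj_fun a x y al)).

Lemma proj_fun_linear a x y (al : arrow x y) : linear (@proj_fun a x y al).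
Proof.
move=> c u v; rewrite /proj_fun scaler_sumr -big_split /=.
by apply: eq_bigr => p _; rewrite !ffunE scalerDl scalerA.
Qed.

Lemma proj_act_basis a x y (al : arrow x y) (p : qpath_fin a x) :
  rep_act (proj a) al (proj_basis p) = proj_basis (qrcons p al : qpath_fin a y).
Proof.
pose lin := GRing.isLinear.Build k _ _ _ _ (@proj_fun_linear a x y al).
pose F : {linear proj_space a x -> proj_space a y} :=
  HB.pack (@proj_fun a x y al) lin.
rewrite [LHS](lfunE F) /= /proj_fun (bigD1 p) //= ffunE eqxx scale1r.
rewrite big1 ?addr0 // => q /negPf qp.
by rewrite ffunE qp scale0r.
Qed.

(* The direct sum of the P_a, a running through a finite list. *)
Definition proj_sum (s : seq (vertex Q)) : rep k Q :=
  foldr (@rep_sum k Q) (rep0 k Q) [seq proj a | a <- s].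

Definition rep_plus : rep k Q -> Prop := fun M =>
  exists (s1 s0 : seq (vertex Q)) (d : rep_hom (proj_sum s1) (proj_sum s0))
    (e : rep_hom (proj_sum s0) M), short_exact d e.

End Projective.

(* Main.v *)
(* The idea is that an extension of a representation Z by a finite dimensional
   L depends only on the restriction of Z to a finite convex set F of vertices
   containing the support of L and its neighbours. Every Z is approximated on F
   by a finitely presented C, the cokernel of the part of the standard
   resolution of Z indexed by F, with a map C -> Z that is an isomorphism on F.
   Hence lifting problems against L -> M -> N can be tested on finitely
   presented representations; and an end term N of an almost split sequence in
   rep(Q) is a retract of its approximation C, hence isomorphic to C.
   Conversely, if the sequence is almost split in rep^+(Q), then L is supported
   on the finitely many vertices between its generators and the relations of N,
   since Ext^1(N, -) vanishes on the rest of L. *)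
From HB Require Import structures.
Require Import Defs.
From mathcomp Require Import all_boot all_algebra.
From mathcomp Require Import boolp classical_sets cardinality.

Set Implicit Arguments.
Unset Strict Implicit.
Unset Printing Implicit Defensive.

Import GRing.Theory.
Local Open Scope ring_scope.
Local Open Scope classical_set_scope.

(** * Paths, intervals and finite convex hulls *)

Section Paths.
Variable Q : quiver.

Fixpoint qcat (x y z : vertex Q) (p : qpath x y) (q : qpath y z) : qpath x z :=
  match q with
  | qnil => p
  | qrcons _ _ q' al => qrcons (qcat p q') al
  end.

Fixpoint qvertices (x y : vertex Q) (p : qpath x y) : seq {classic vertex Q} :=
  match p with
  | qnil => [:: x]
  | qrcons _ z p' _ => (z : {classic vertex Q}) :: qvertices p'
  end.

Lemma mem_target_qvertices (x y : vertex Q) (p : qpath x y) :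
  (y : {classic vertex Q}) \in qvertices p.
Proof. by case: p => [|u v p al] /=; rewrite ?in_cons ?eqxx ?mem_seq1. Qed.

Lemma mem_qvertices_cat (x y z : vertex Q) (p : qpath x y) (q : qpath y z) :
  (y : {classic vertex Q}) \in qvertices (qcat p q).
Proof.
elim: q => [|u v q IH al] /=; first exact: mem_target_qvertices.
by rewrite in_cons IH orbT.
Qed.

Definition between (S T : set (vertex Q)) : set (vertex Q) :=
  [set y | exists x z, [/\ S x, T z & inhabited (qpath x y * qpath y z)]].

(** A vertex between [S] and [T] lies on one of the finitely many paths from [S] to [T], and each
    path has finitely many vertices. *)
Lemma finite_between (S T : set (vertex Q)) : interval_finite Q ->
  finite_set S -> finite_set T -> finite_set (between S T).
Proof.
move=> fQ fS fT.
pose P := \bigcup_(x in S) \bigcup_(z in T)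
  \bigcup_(p in [set: qpath x z]) [set` qvertices p].
have fP : finite_set P.
  apply: bigcup_finite => // x _; apply: bigcup_finite => // z _.
  by apply: bigcup_finite => [|p _]; [exact: fQ | exact: finite_seq].
apply: sub_finite_set fP => y [x [z [Sx Tz [[p q]]]]].
exists x => //; exists z => //; exists (qcat p q) => //=.
exact: mem_qvertices_cat.
Qed.

Definition convex (F : seq {classic vertex Q}) :=
  forall (x y z : vertex Q), (x : {classic vertex Q}) \in F ->
    (z : {classic vertex Q}) \in F ->
    qpath x y -> qpath y z -> (y : {classic vertex Q}) \in F.

Lemma convex_hull (S : set (vertex Q)) : interval_finite Q -> finite_set S ->
  exists F : seq {classic vertex Q}, convex F /\ S `<=` [set` F].
Proof.
move=> fQ fS; have fH := finite_between fQ fS fS.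
have /(@finite_seqP {classic vertex Q})[F defF] := fH.
exists F; split=> [x y z xF zF p q|x Sx].
  have : between S S x by rewrite defF.
  have : between S S z by rewrite defF.
  move=> [_ [z' [_ Sz' [[_ q']]]]] [x' [_ [Sx' _ [[p' _]]]]].
  suff : between S S y by rewrite defF.
  by exists x', z'; split=> //; exact: (inhabits (qcat p' p, qcat q q')).
suff : between S S x by rewrite defF.
by exists x, x; split=> //; exact: (inhabits (qnil x, qnil x)).
Qed.

End Paths.

(** * Morphisms, exactness, cokernels and factorizations, computed at each vertex *)

Section Representations.
Variables (k : fieldType) (Q : quiver).
Implicit Types L M N X Y Z : rep k Q.

Lemma rep_hom_ext X Y (f g : rep_hom X Y) : (forall x, f x =1 g x) -> f = g.
Proof.
case: f g => f fn [g gn] /= fg.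
have {}fg : f = g by apply: functional_extensionality_dep => x; apply/lfunP/fg.
by case: _ / fg in gn *; congr RepHom; exact: Prop_irrelevance.
Qed.

Lemma hom_natE X Y (f : rep_hom X Y) x y (al : arrow x y) u :
  f y (rep_act X al u) = rep_act Y al (f x u).
Proof. by rewrite -!comp_lfunE hom_nat. Qed.

Lemma hom_compE X Y Z (g : rep_hom Y Z) (f : rep_hom X Y) x u :
  hom_comp g f x u = g x (f x u).
Proof. exact: comp_lfunE. Qed.

Lemma rep_hom_of X Y (h : forall x, 'Hom(X x, Y x)) :
    (forall x y (al : arrow x y) u,
      h y (rep_act X al u) = rep_act Y al (h x u)) ->
  exists f : rep_hom X Y, forall x, f x = h x.
Proof.
move=> hn; have hn' x y (al : arrow x y) :
    (h y \o rep_act X al = rep_act Y al \o h x)%VF.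
  by apply/lfunP => u; rewrite !comp_lfunE hn.
by exists (RepHom hn').
Qed.

Fixpoint path_act X x y (p : qpath x y) : 'Hom(X x, X y) :=
  match p with
  | qnil => \1%VF
  | qrcons _ _ p' al => (rep_act X al \o path_act X p')%VF
  end.

Lemma path_act_nil X x u : path_act X (qnil x) u = u.
Proof. exact: id_lfunE. Qed.

Lemma path_act_rcons X x y z (p : qpath x y) (al : arrow y z) u :
  path_act X (qrcons p al) u = rep_act X al (path_act X p u).
Proof. exact: comp_lfunE. Qed.

Lemma path_act_cat X x y z (p : qpath x y) (q : qpath y z) u :
  path_act X (qcat p q) u = path_act X q (path_act X p u).
Proof.
elim: q => [|v w q IH al] /=; first by rewrite id_lfunE.
by rewrite !comp_lfunE IH.
Qed.

Lemma path_act_hom X Y (f : rep_hom X Y) x y (p : qpath x y) u :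
  f y (path_act X p u) = path_act Y p (f x u).
Proof.
elim: p => [|v w p IH al] /=; first by rewrite !id_lfunE.
by rewrite !comp_lfunE hom_natE IH.
Qed.

Lemma path_act_sum X Y x y (p : qpath x y) (u : X x * Y x) :
  path_act (rep_sum X Y) p u = (path_act X p u.1, path_act Y p u.2).
Proof.
elim: p => [|v w p IH al] /=; first by rewrite !id_lfunE; case: u.
by rewrite !comp_lfunE IH rep_sumE.
Qed.

Lemma lfun_inj_ker (V W : vectType k) (h : 'Hom(V, W)) :
  (forall u, h u = 0 -> u = 0) -> lker h = 0%VS.
Proof.
move=> hh; apply/eqP/lker0P => u v uv; apply/eqP; rewrite -subr_eq0; apply/eqP.
by apply: hh; rewrite linearB /= uv subrr.
Qed.

Lemma limg_fullP (V W : vectType k) (h : 'Hom(V, W)) :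
  limg h = fullv <-> forall w, exists v, h v = w.
Proof.
split=> [hh w|hh].
  by have : w \in limg h by [rewrite hh memvf]; case/memv_imgP=> v _ ->; exists v.
apply/vspaceP => w; rewrite memvf.
by have [v <-] := hh w; rewrite memv_img ?memvf.
Qed.

Section ShortExact.
Variables (L M N : rep k Q) (f : rep_hom L M) (g : rep_hom M N).
Hypothesis fg : short_exact f g.

Lemma short_exact_surj x w : exists v, g x v = w.
Proof. by case: (fg x) => _ _ /limg_fullP. Qed.

Lemma short_exact_comp x u : g x (f x u) = 0.
Proof.
case: (fg x) => _ E _; apply/eqP; rewrite -memv_ker -E; exact: memv_img (memvf _).
Qed.

Lemma short_exact_lift x v : g x v = 0 -> exists u, v = f x u.
Proof.
case: (fg x) => _ E _ /eqP; rewrite -memv_ker -E.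
by case/memv_imgP=> u _ ->; exists u.
Qed.

End ShortExact.

(** The quotient is realized on a complement of the image at each vertex, the arrows of [Y] being
    compressed to it; the projection is natural because arrows preserve the image of [d]. *)
Lemma cokernel X Y (d : rep_hom X Y) :
  exists (C : rep k Q) (q : rep_hom Y C),
    forall x, limg (q x) = fullv /\ lker (q x) = limg (d x).
Proof.
pose U x := limg (d x).
pose C x : vectType k := subvs_of (U x)^C%VS.
pose q x : 'Hom(Y x, C x) :=
  (linfun (vsproj (U x)^C) \o daddv_pi (U x)^C (U x))%VF.
pose i x : 'Hom(C x, Y x) := linfun (@vsval k (Y x) (U x)^C).
have dx x : ((U x)^C :&: U x = 0)%VS by rewrite capvC capv_compl.
have qE x u : vsval (q x u) = daddv_pi (U x)^C (U x) u.
  by rewrite comp_lfunE lfunE /= vsprojK ?memv_pi.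
have iE x u : i x u = vsval u by rewrite lfunE.
(* The splitting of [Y x] into the complement and the image of [d]. *)
have dec x u : exists w, u = i x (q x u) + d x w.
  have /memv_imgP[w _ E] : daddv_pi (U x) (U x)^C u \in limg (d x).
    exact: memv_pi.
  exists w; rewrite -E iE qE daddv_pi_add //.
  by rewrite addvC addv_complf memvf.
have qd x w : q x (d x w) = 0.
  apply/val_inj; rewrite /= qE.
  have Uw : d x w \in U x by apply: memv_img (memvf _).
  have : daddv_pi (U x)^C (U x) (d x w) + daddv_pi (U x) (U x)^C (d x w) = d x w.
    by rewrite daddv_pi_add // addvC addv_complf memvf.
  by rewrite (daddv_pi_id (capv_compl _)) // => /(canRL (addrK _)); rewrite subrr.
have qi x c : q x (i x c) = c.
  by apply/val_inj; rewrite /= qE daddv_pi_id ?dx ?iE ?subvsP.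
pose R : rep k Q := Rep (fun x y al => (q y \o rep_act Y al \o i x)%VF).
have [h hE] : exists h : rep_hom Y R, forall x, h x = q x.
  apply: rep_hom_of => x y al u /=; rewrite -[RHS]/((_ \o _ \o _)%VF _).
  rewrite (comp_lfunE (q y \o _)%VF) (comp_lfunE (q y)); have [w {1}->] := dec x u.
  by rewrite !linearD /= -(hom_natE d) qd addr0.
exists R, h => x; rewrite hE; split.
  by apply/limg_fullP => c; exists (i x c).
apply/vspaceP => u; rewrite memv_ker; apply/eqP/idP => [qu|].
  by have [w ->] := dec x u; rewrite qu linear0 add0r memv_img ?memvf.
by case/memv_imgP => w _ ->; exact: qd.
Qed.

(** A linear right inverse of [q] at each vertex gives the map; it is independent of the choice
    since the kernel of [q] lies in that of [e], whence naturality. *)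
Lemma factor_epi X Y Z (q : rep_hom X Y) (e : rep_hom X Z) :
    (forall x, limg (q x) = fullv) ->
    (forall x u, q x u = 0 -> e x u = 0) ->
  exists h : rep_hom Y Z, hom_comp h q = e.
Proof.
move=> qs qe.
have eqq x u v : q x u = q x v -> e x u = e x v.
  move=> uv; apply/eqP; rewrite -subr_eq0 -linearB; apply/eqP/qe.
  by rewrite linearB /= uv subrr.
pose h x := (e x \o (q x)^-1)%VF.
have hq x u : h x (q x u) = e x u.
  by rewrite comp_lfunE; apply: eqq; rewrite limg_lfunVK // memv_img ?memvf.
have [h' h'E] : exists h' : rep_hom Y Z, forall x, h' x = h x.
  apply: rep_hom_of => x y al v; have /limg_fullP/(_ v)[u <-] := qs x.
  by rewrite -hom_natE !hq hom_natE.
by exists h'; apply: rep_hom_ext => x u; rewrite hom_compE h'E hq.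
Qed.

End Representations.

(** * Universal property of finite direct sums of the representations P_a *)

Section Free.
Variables (k : fieldType) (Q : quiver).
Implicit Types R X Y : rep k Q.

(* The vectors [p . b_j], for [j] in [js] and [p] a path from [t j] to [v],
   form a basis of [R v] for every vertex [v]. *)
Definition basis_on R (J : eqType) (js : seq J) (t : J -> vertex Q)
    (b : forall j, R (t j)) :=
  (forall v (W : vectType k) (w : forall j, qpath (t j) v -> W),
    exists phi : 'Hom(R v, W),
      forall j (p : qpath (t j) v), j \in js -> phi (path_act R p (b j)) = w j p)
  /\ (forall v (W : vectType k) (phi psi : 'Hom(R v, W)),
    (forall j (p : qpath (t j) v), j \in js ->
      phi (path_act R p (b j)) = psi (path_act R p (b j))) -> phi = psi).

(* Basis-free form of [basis_on]: through [io], [R] is the direct sum over [js]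
   of the representations [V_j] tensor [P_(t j)]. *)
Definition free_on R (J : eqType) (js : seq J) (t : J -> vertex Q)
    (V : J -> vectType k) (io : forall j, 'Hom(V j, R (t j))) :=
  (forall v (W : vectType k) (w : forall j, qpath (t j) v -> 'Hom(V j, W)),
    exists phi : 'Hom(R v, W), forall j (p : qpath (t j) v) m, j \in js ->
      phi (path_act R p (io j m)) = w j p m)
  /\ (forall v (W : vectType k) (phi psi : 'Hom(R v, W)),
    (forall j (p : qpath (t j) v) m, j \in js ->
      phi (path_act R p (io j m)) = psi (path_act R p (io j m))) -> phi = psi).

Section FreeHom.
Variables (R : rep k Q) (J : eqType) (js : seq J) (t : J -> vertex Q).
Variables (V : J -> vectType k) (io : forall j, 'Hom(V j, R (t j))).
Hypothesis fr : free_on js io.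

(** The image of p . [io j m] has to be p . [c j m]; the uniqueness half of [free_on] turns this
    vertexwise choice into a natural one. *)
Lemma free_on_hom Y (c : forall j, 'Hom(V j, Y (t j))) :
  exists h : rep_hom R Y, forall j m, j \in js -> h (t j) (io j m) = c j m.
Proof.
have [ex un] := fr.
pose ext v := cid (ex v (Y v) (fun j p => (path_act Y p \o c j)%VF)).
pose h v := sval (ext v); have hE v := svalP (ext v).
have [h' h'E] : exists h' : rep_hom R Y, forall x, h' x = h x.
  apply: rep_hom_of => x y al u.
  rewrite -!comp_lfunE; congr (fun_of_lfun _ u); apply: un => j p m jj.
  by rewrite !comp_lfunE -path_act_rcons hE // hE // !comp_lfunE.
exists h' => j m jj; rewrite h'E -[io j m](path_act_nil (X := R)) hE // comp_lfunE.
by rewrite path_act_nil.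
Qed.

Lemma free_on_hom_ext Y (h1 h2 : rep_hom R Y) :
  (forall j m, j \in js -> h1 (t j) (io j m) = h2 (t j) (io j m)) -> h1 = h2.
Proof.
move=> h12; apply: rep_hom_ext => v u; congr (fun_of_lfun _ u).
by apply: fr.2 => j p m jj; rewrite !path_act_hom h12.
Qed.

Lemma free_on_hom0 Y (h : rep_hom R Y) :
  (forall j m, j \in js -> h (t j) (io j m) = 0) -> forall v u, h v u = 0.
Proof.
move=> h0 v u; suff -> : h v = 0 by rewrite zero_lfunE.
by apply: fr.2 => j p m jj; rewrite path_act_hom h0 // linear0 zero_lfunE.
Qed.

Lemma free_on_support v :
  (forall j, j \in js -> qpath (t j) v -> False) -> forall u : R v, u = 0.
Proof.
move=> nv u; rewrite -[u]id_lfunE; suff -> : \1%VF = 0 :> 'Hom(R v, R v).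
  exact: zero_lfunE.
by apply: fr.2 => j p m jj; case: (nv j jj p).
Qed.

End FreeHom.

Variable fQ : interval_finite Q.

Lemma path_act_proj_nil a v (p : qpath a v) :
  path_act (proj k fQ a) p (proj_basis k (qnil a : qpath_fin fQ a a)) =
  proj_basis k (p : qpath_fin fQ a v).
Proof.
elim: p => [|x y p IH al]; first exact: path_act_nil.
by rewrite path_act_rcons IH proj_act_basis.
Qed.

Lemma proj_space_decomp a v (u : proj k fQ a v) :
  u = \sum_(p : qpath_fin fQ a v) (u : proj_space k fQ a v) p *: proj_basis k p.
Proof.
apply/ffunP => q; rewrite sum_ffunE (bigD1 q) //= big1 => [|p /negPf pq].
  by rewrite !ffunE eqxx addr0 [RHS]mulr1.
by rewrite !ffunE eq_sym pq scaler0.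
Qed.

Lemma pair_injections (V W : vectType k) :
  exists (i1 : 'Hom(V, (V * W)%type)) (i2 : 'Hom(W, (V * W)%type)),
    (forall u, i1 u = (u, 0)) /\ (forall u, i2 u = (0, u)).
Proof.
have lin1 : linear (fun u : V => (u, 0) : (V * W)%type).
  by move=> c u v; congr pair; rewrite /= scaler0 addr0.
have lin2 : linear (fun u : W => (0, u) : (V * W)%type).
  by move=> c u v; congr pair; rewrite /= scaler0 addr0.
pose m1 := GRing.isLinear.Build k _ _ _ _ lin1.
pose m2 := GRing.isLinear.Build k _ _ _ _ lin2.
pose F1 : {linear V -> (V * W)%type} :=
  HB.pack (fun u : V => (u, 0) : (V * W)%type) m1.
pose F2 : {linear W -> (V * W)%type} :=
  HB.pack (fun u : W => (0, u) : (V * W)%type) m2.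
by exists (linfun F1), (linfun F2); split=> u; rewrite lfunE.
Qed.

Lemma basis_on_proj_cons (J : eqType) (j0 : J) (js : seq J) (t : J -> vertex Q) R
    (b : forall j, R (t j)) : j0 \notin js -> basis_on js b ->
  exists b' : forall j, rep_sum (proj k fQ (t j0)) R (t j),
    basis_on (j0 :: js) b'.
Proof.
move=> j0js [ex un]; set P := proj k fQ (t j0).
pose b0 : rep_sum P R (t j0) :=
  (proj_basis k (qnil (t j0) : qpath_fin fQ (t j0) (t j0)), 0).
(* The type depends on [j], so the new basis vector [b0] is transported along [j0 = j]. *)
pose b' j : rep_sum P R (t j) := match j0 =P j with
  | ReflectT e => eq_rect j0 (fun j => rep_sum P R (t j)) b0 j e
  | ReflectF _ => (0, b j) end.
have b'0 v (p : qpath (t j0) v) :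
    path_act (rep_sum P R) p (b' j0) = (proj_basis k (p : qpath_fin fQ _ _), 0).
  rewrite /b'; case: eqP => // e; rewrite (eq_axiomK e) /=.
  by rewrite (path_act_sum (X := P)) /= linear0 path_act_proj_nil.
have b'S v j (p : qpath (t j) v) : j \in js ->
    path_act (rep_sum P R) p (b' j) = (0, path_act R p (b j)).
  move=> jj; rewrite /b'; case: eqP => [e|_]; first by case/negP: j0js; rewrite e.
  by rewrite (path_act_sum (X := P)) /= linear0.
exists b'; split=> [v W w|v W phi psi eqb].
  have [phi phiE] := ex v W w.
  pose F (u : rep_sum P R v) : W :=
    \sum_(p : qpath_fin fQ (t j0) v) (u.1 : proj_space k fQ _ _) p *: w j0 p
    + phi u.2.
  have Flin : linear F.
    move=> c u1 u2; rewrite /F /= linearP /= scalerDr addrACA; congr (_ + _).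
    rewrite scaler_sumr -big_split /=; apply: eq_bigr => p _.
    by rewrite !ffunE scalerDl scalerA.
  pose lin := GRing.isLinear.Build k _ _ _ _ Flin.
  pose F' : {linear rep_sum P R v -> W} := HB.pack F lin.
  exists (linfun F') => j p; rewrite in_cons => jj; rewrite lfunE /=.
  case: (eqVneq j j0) p jj => [-> p _|_ p /= jj]; last first.
    rewrite b'S // /F /= phiE // big1 ?add0r // => q _.
    by rewrite ffunE scale0r.
  rewrite b'0 /F /= linear0 addr0 (bigD1 (p : qpath_fin fQ _ _)) //= ffunE eqxx.
  by rewrite scale1r big1 ?addr0 // => q /negPf qp; rewrite ffunE qp scale0r.
have [i1 [i2 [i1E i2E]]] := pair_injections (P v) (R v).
have E1 : (phi \o i1)%VF = (psi \o i1)%VF.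
  apply/lfunP => u; rewrite (proj_space_decomp u) !linear_sum.
  apply: eq_bigr => p _; rewrite !linearZ; congr (_ *: _).
  by rewrite /= !comp_lfunE i1E -b'0 eqb ?mem_head.
have E2 : (phi \o i2)%VF = (psi \o i2)%VF.
  apply: un => j p jj; rewrite !comp_lfunE i2E -b'S // eqb //.
  by rewrite in_cons jj orbT.
apply/lfunP => -[u1 u2].
have -> : (u1, u2) = i1 u1 + i2 u2.
  by rewrite i1E i2E; congr pair; rewrite /= ?addr0 ?add0r.
by rewrite !linearD /= -!comp_lfunE E1 E2.
Qed.

Lemma proj_sum_basis (J : eqType) (js : seq J) (t : J -> vertex Q) : uniq js ->
  exists b : forall j, proj_sum k fQ [seq t j | j <- js] (t j), basis_on js b.
Proof.
elim: js => [_|j0 js IH /= /andP[j0js /IH[b bP]]]; last first.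
  exact: basis_on_proj_cons bP.
exists (fun=> 0); split=> [v W w|v W phi psi _]; first by exists 0.
apply/lfunP => u; have -> : u = 0 by exact: thinmx0.
by rewrite !linear0.
Qed.

(** A basis of [V j] splits [V j] tensor P_(t j) into [\dim {: V j}] copies of P_(t j), so the
    summands are indexed by pairs of [j] and a basis index. *)
Lemma free_on_proj_sum (J : eqType) (js : seq J) (t : J -> vertex Q)
    (V : J -> vectType k) :
  exists s (io : forall j, 'Hom(V j, proj_sum k fQ s (t j))), free_on js io.
Proof.
pose J' : eqType := {j : J & 'I_(\dim {: V j})}.
pose tg j (l : 'I_(\dim {: V j})) : J' := existT _ j l.
(* [js] may have repetitions; only membership in it matters for [free_on], while [proj_sum_basis]
   needs a duplicate-free list. *)
pose js' : seq J' := undup [seq tg j l | j <- js, l <- enum 'I_(\dim {: V j})].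
have js'E j (l : 'I_(\dim {: V j})) :
    (tg j l \in js') = (j \in js).
  rewrite mem_undup; apply/allpairsPdep/idP => [[j' [l' [j'js _]]]|jj].
    by move/(congr1 (fun i : J' => tag i)) => /= ->.
  by exists j, l; rewrite mem_enum.
have [b [ex un]] :=
  proj_sum_basis (fun i : J' => t (tag i)) (undup_uniq _ : uniq js').
set s := [seq _ | _ <- _] in b ex un.
pose e j (l : 'I_(\dim {: V j})) := (vbasis {: V j})`_l.
pose b' j l : proj_sum k fQ s (t j) := b (tg j l).
pose F j (m : V j) : proj_sum k fQ s (t j) :=
  \sum_l coord (vbasis {: V j}) l m *: b' j l.
have Flin j : linear (@F j).
  move=> c u v; rewrite /F scaler_sumr -big_split /=; apply: eq_bigr => l _.
  by rewrite linearP /= scalerDl scalerA.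
pose lin j := GRing.isLinear.Build k _ _ _ _ (Flin j).
pose F' j : {linear V j -> proj_sum k fQ s (t j)} := HB.pack (@F j) (lin j).
have FE v j (p : qpath (t j) v) m :
    path_act (proj_sum k fQ s) p (linfun (F' j) m) =
    \sum_l coord (vbasis {: V j}) l m *: path_act _ p (b' j l).
  rewrite lfunE /= /F linear_sum; apply: eq_bigr => l _; exact: linearZ.
have Fe v j (p : qpath (t j) v) l :
    path_act (proj_sum k fQ s) p (linfun (F' j) (e j l)) = path_act _ p (b' j l).
  have fe j' : free (vbasis {: V j'}) := basis_free (vbasisP _).
  rewrite FE (bigD1 l) //= big1 => [|l' /negPf l'l]; rewrite /e coord_free //.
    by rewrite eqxx scale1r addr0.
  by rewrite eq_sym l'l scale0r.
exists s, (fun j => linfun (F' j)); split=> [v W w|v W phi psi eqio].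
  have [phi phiE] := ex v W
    (fun i : J' => fun p => w (tag i) p (e (tag i) (tagged i))).
  exists phi => j p m jj.
  rewrite FE linear_sum {2}(coord_vbasis (memvf m)) linear_sum.
  apply: eq_bigr => l _; rewrite !linearZ /=; congr (_ *: _).
  by rewrite (phiE (tg _ l)) // js'E.
apply: (un v W phi psi) => -[j l] p; rewrite -[existT _ j l]/(tg j l) js'E => jj.
by rewrite -(Fe v j p l) eqio.
Qed.

Lemma free_on_basis R (J : eqType) (js : seq J) (t : J -> vertex Q)
    (b : forall j, R (t j)) : basis_on js b ->
  exists io : forall j, 'Hom(k^o : vectType k, R (t j)), free_on js io.
Proof.
move=> [ex un].
have lin j : linear (fun a : k^o => a *: b j).
  by move=> c u v; rewrite scalerDl scalerA.
pose m j := GRing.isLinear.Build k _ _ _ _ (lin j).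
pose F j : {linear k^o -> R (t j)} := HB.pack (fun a : k^o => a *: b j) (m j).
exists (fun j => linfun (F j)); split=> [v W w|v W phi psi eqio].
  have [phi phiE] := ex v W (fun j p => w j p 1).
  exists phi => j p a jj; rewrite lfunE /= !linearZ /= phiE // -linearZ /=.
  by rewrite [_ *: _]mulr1.
apply: un => j p jj; have := eqio j p 1 jj.
by rewrite lfunE /= scale1r.
Qed.

Lemma proj_sum_free (s : seq (vertex Q)) :
  exists io : forall j,
      'Hom(k^o : vectType k, proj_sum k fQ s (tnth (in_tuple s) j)),
    free_on (enum 'I_(size s)) io.
Proof.
have := proj_sum_basis (tnth (in_tuple s)) (enum_uniq 'I_(size s)).
by rewrite map_tnth_enum => -[b /free_on_basis].
Qed.
End Free.

(** * Finite dimension as finite support *)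

Section Support.
Variables (k : fieldType) (Q : quiver).
Implicit Types L M N X Y Z : rep k Q.

Definition supported_in (S : set (vertex Q)) L :=
  forall x (u : L x), ~ S x -> u = 0.

Lemma rep_bP L : rep_b L <-> exists S, finite_set S /\ supported_in S L.
Proof.
split=> [[n Ln]|[S [/(@finite_seqP {classic vertex Q})[F ->] SL]]].
  pose S : set {classic vertex Q} := [set x | \dim {: L x} != 0].
  exists S; split=> [|x u /negP]; last first.
    by rewrite negbK dimv_eq0 => /eqP E; apply/eqP; rewrite -memv0 -E memvf.
  (* With infinite support, n + 1 vertices of the support would already give total dimension above
     the bound n. *)
  apply: contrapT => infS.
  have [B BS nB] := @infinite_set_fset {classic vertex Q} _ n.+1 infS.
  suff : (n < n)%N by rewrite ltnn.
  apply: (leq_trans nB); rewrite -sum1_size.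
  apply: leq_trans (Ln _ (finmap.fset_uniq B)).
  by rewrite big_seq [leqRHS]big_seq leq_sum // => x xB; rewrite lt0n; exact: BS.
exists (\sum_(x <- undup F) \dim {: L x})%N => s us.
rewrite (bigID (mem F)) /= [X in (_ + X)%N]big1 ?addn0 => [|x xF]; last first.
  apply/eqP; rewrite dimv_eq0 -subv0; apply/subvP => u _.
  by rewrite (SL x u) ?mem0v //; exact/negP.
rewrite -big_filter.
apply: (@uniq_sub_le_big _ _ leq) => //; rewrite ?filter_uniq ?undup_uniq //.
- by move=> i j; exact: leq_addr.
- by move=> x; rewrite mem_filter mem_undup => /andP[].
Qed.
End Support.

(** * Finitely presented approximations on a finite convex set *)

Section Approximation.
Variables (k : fieldType) (Q : quiver).
Implicit Types L M N X Y Z : rep k Q.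

Definition arrow_total := {x : vertex Q & {y : vertex Q & arrow x y}}.

Definition to_total x y (al : arrow x y) : {classic arrow_total} :=
  existT (fun x => {y : vertex Q & arrow x y}) x (existT _ y al).

Lemma arrows_within (F : seq {classic vertex Q}) : locally_finite Q ->
  exists A : seq {classic arrow_total}, forall x y (al : arrow x y),
    to_total al \in A <->
    (x : {classic vertex Q}) \in F /\ (y : {classic vertex Q}) \in F.
Proof.
move=> lfQ; pose S : set {classic arrow_total} := [set a |
  (tag a : {classic vertex Q}) \in F /\
  (tag (tagged a) : {classic vertex Q}) \in F].
have : finite_set S.
  pose T : set {classic arrow_total} :=
    \bigcup_(x in [set` F]) ((fun b => existT _ x b) @` [set: {y & arrow x y}]).
  have fT : finite_set T.
    apply: bigcup_finite => [|x _]; first exact: finite_seq.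
    exact: finite_image (lfQ x).1.
  by apply: sub_finite_set fT => -[x b] [/= xF _]; exists x => //; exists b.
move=> /finite_seqP[A SA]; exists A => x y al.
suff : S (to_total al) <-> to_total al \in A by move=> <-.
by rewrite SA.
Qed.

(* The contracting homotopy of the standard resolution, on the summand
   [X x] tensor [p]. *)
Fixpoint homotopy X (P1 : rep k Q)
    (io : forall x y (al : arrow x y), 'Hom(X x, P1 y)) x v (p : qpath x v) :
    'Hom(X x, P1 v) :=
  match p with
  | qnil => 0
  | qrcons _ _ p' al =>
      ((rep_act P1 al \o homotopy io p') + (io _ _ al \o path_act X p'))%VF
  end.

Lemma homotopy_rcons X (P1 : rep k Q)
    (io : forall x y (al : arrow x y), 'Hom(X x, P1 y)) x y z (p : qpath x y)
    (al : arrow y z) m :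
  homotopy io (qrcons p al) m =
  rep_act P1 al (homotopy io p m) + io _ _ al (path_act X p m).
Proof. by rewrite /= lfunE /= !comp_lfunE. Qed.

(** The terms of the two homotopies cancel except the one for the first arrow. The left side is the
    homotopy applied to the differential of p . [io al m], so this is what makes the differential
    injective. *)
Lemma homotopy_prepend X (P1 : rep k Q)
    (io : forall x y (al : arrow x y), 'Hom(X x, P1 y)) x y v (al : arrow x y)
    (p : qpath y v) m :
  homotopy io (qcat (qrcons (qnil x) al) p) m - homotopy io p (rep_act X al m) =
  path_act P1 p (io x y al m).
Proof.
elim: p => [|z w p IH be]; last first.
  rewrite path_act_rcons -IH [qcat _ _]/= !homotopy_rcons path_act_cat.
  by rewrite path_act_rcons path_act_nil linearB /= opprD addrACA subrr addr0.
rewrite [qcat _ _]/= homotopy_rcons /= !id_lfunE.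
by rewrite !zero_lfunE linear0 add0r subr0.
Qed.

(* [pi : C -> X] is an isomorphism at the vertices of [F], with inverses [rho],
   and [C] is generated by its restriction to [F]. *)
Definition approximation (F : seq {classic vertex Q}) C X (pi : rep_hom C X)
    (rho : forall x, 'Hom(X x, C x)) :=
  [/\ forall x, (x : {classic vertex Q}) \in F -> cancel (pi x) (rho x),
      forall x, (x : {classic vertex Q}) \in F -> cancel (rho x) (pi x)
    & forall Y (phi psi : rep_hom C Y),
        (forall x u, (x : {classic vertex Q}) \in F -> phi x u = psi x u) ->
        phi = psi].

(* [C] is the cokernel of the part of the standard projective resolution of [X]
   that is indexed by the vertices of [F] and the arrows between them. *)
Lemma approximation_exists (hQ : strongly_locally_finite Q)
    (F : seq {classic vertex Q}) X : convex F ->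
  exists C (pi : rep_hom C X) rho, rep_plus hQ.2 C /\ approximation F pi rho.
Proof.
move=> cF; have [A AE] := arrows_within F hQ.1.
have [s0 [io0 fr0]] := free_on_proj_sum hQ.2 F (fun x => x) (fun x => X x).
have [s1 [io1 fr1]] := free_on_proj_sum hQ.2 A
  (fun a : {classic arrow_total} => tag (tagged a)) (fun a => X (tag a)).
set P0 := proj_sum _ _ s0 in io0 fr0; set P1 := proj_sum _ _ s1 in io1 fr1.
have [d dE] := free_on_hom fr1 (Y := P0) (fun a =>
  (rep_act P0 (tagged (tagged a)) \o io0 (tag a))%VF -
  (io0 (tag (tagged a)) \o rep_act X (tagged (tagged a)))%VF).
have {}dE x y (al : arrow x y) m : (x : {classic vertex Q}) \in F ->
    (y : {classic vertex Q}) \in F ->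
    d y (io1 (to_total al) m) = rep_act P0 al (io0 x m) - io0 y (rep_act X al m).
  move=> xF yF; rewrite (dE (to_total al)) ?AE //.
  by rewrite lfunE /= opp_lfunE !comp_lfunE.
have [e eE] := free_on_hom fr0 (Y := X) (fun x => \1%VF).
have {}eE x m : (x : {classic vertex Q}) \in F -> e x (io0 x m) = m.
  by move=> xF; rewrite eE // id_lfunE.
pose H := @homotopy X P1 (fun x y al => io1 (to_total al)).
have hex v : exists h : 'Hom(P0 v, P1 v), forall x (p : qpath x v) m,
    (x : {classic vertex Q}) \in F -> h (path_act P0 p (io0 x m)) = H x v p m.
  exact: (fr0.1 v (P1 v) (fun x p => H x v p)).
have d_inj v : lker (d v) = 0%VS.
  have [h hE] := hex v.
  suff E : (h \o d v = \1)%VF.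
    apply: lfun_inj_ker => u du; rewrite -[u]id_lfunE -E comp_lfunE du.
    exact: linear0.
  apply: fr1.2 => -[x [y al]] p m /AE[xF yF] /=.
  rewrite comp_lfunE id_lfunE path_act_hom (dE x y al) // linearB /= linearB /=.
  have -> : path_act P0 p (rep_act P0 al (io0 x m)) =
      path_act P0 (qcat (qrcons (qnil x) al) p) (io0 x m).
    by rewrite path_act_cat path_act_rcons path_act_nil.
  by rewrite !hE // [LHS]homotopy_prepend.
(* The other homotopy identity, d h + [io0] e = 1. It is proved by induction on paths ending in [F];
   convexity keeps their intermediate vertices in [F], where [dE] applies. *)
have decomp v (h : 'Hom(P0 v, P1 v)) : (v : {classic vertex Q}) \in F ->
    (forall x (p : qpath x v) m, (x : {classic vertex Q}) \in F ->
      h (path_act P0 p (io0 x m)) = H x v p m) ->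
    forall xi, xi = d v (h xi) + io0 v (e v xi).
  move=> vF hE xi.
  suff E : ((d v \o h) + (io0 v \o e v) = \1)%VF.
    by rewrite -{1}[xi]id_lfunE -E lfunE /= !comp_lfunE.
  apply: fr0.2 => x p m xF; rewrite lfunE /= !comp_lfunE id_lfunE hE //.
  rewrite path_act_hom eE //.
  elim: p vF {h hE} => [|y w p IH al] vF.
    by rewrite /H /= zero_lfunE linear0 add0r !path_act_nil.
  have yF : (y : {classic vertex Q}) \in F.
    exact: (cF x y w xF vF p (qrcons (qnil y) al)).
  rewrite [H _ _ _ _]homotopy_rcons linearD /= dE // hom_natE !path_act_rcons.
  by rewrite -(IH yF) linearD /= addrA subrK.
have [C [q qE]] := cokernel d.
have qd x u : q x (d x u) = 0.
  by apply/eqP; rewrite -memv_ker (qE x).2 memv_img ?memvf.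
have ed x u : e x (d x u) = 0.
  rewrite -hom_compE; apply: (free_on_hom0 fr1) => -[y [z al]] m /AE[yF zF] /=.
  by rewrite hom_compE (dE y z al) // linearB /= hom_natE !eE // subrr.
have [pi piE] : exists pi : rep_hom C X, hom_comp pi q = e.
  apply: factor_epi => [x|x u]; first exact: (qE x).1.
  move/eqP; rewrite -memv_ker (qE x).2 => /memv_imgP[w _ ->]; exact: ed.
have piqE x u : pi x (q x u) = e x u by rewrite -hom_compE piE.
(* Applying [q] to [decomp] kills the d-term, so [q io0] inverts [pi] on [F]. *)
exists C, pi, (fun x => q x \o io0 x)%VF; split.
  exists s1, s0, d, q => x; split; first exact: d_inj.
    by rewrite (qE x).2.
  exact: (qE x).1.
split=> [x xF u|x xF m|Y phi psi pp].
- have [w <-] := (limg_fullP (q x)).1 (qE x).1 u.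
  have [h hE] := hex x; rewrite comp_lfunE piqE {2}(decomp x h xF hE w).
  by rewrite linearD /= qd add0r.
- by rewrite comp_lfunE piqE eE.
have E : hom_comp phi q = hom_comp psi q.
  by apply: (free_on_hom_ext fr0) => x m xF; rewrite !hom_compE pp.
apply: rep_hom_ext => x u; have [w <-] := (limg_fullP (q x)).1 (qE x).1 u.
by rewrite -!hom_compE E.
Qed.
End Approximation.

(** * Passing between a representation and its approximation *)

Section Descent.
Variables (k : fieldType) (Q : quiver).
Implicit Types C L M N X Y Z : rep k Q.

Lemma rep_plus_iso (fQ : interval_finite Q) C X (pi : rep_hom C X)
    (s : rep_hom X C) :
  rep_plus fQ C -> hom_comp pi s = hom_id X -> hom_comp s pi = hom_id C ->
  rep_plus fQ X.
Proof.
move=> [s1 [s0 [d [e de]]]] ps sp; exists s1, s0, d, (hom_comp pi e) => x.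
have pis u : pi x (s x u) = u by rewrite -hom_compE ps /= id_lfunE.
have spi u : s x (pi x u) = u by rewrite -hom_compE sp /= id_lfunE.
case: (de x) => d0 dE eE; split=> //.
  apply/vspaceP => u; rewrite dE !memv_ker hom_compE.
  by rewrite -[e x u == 0](can_eq spi) linear0.
apply/limg_fullP => v; have [u uE] := (limg_fullP (e x)).1 eE (s x v).
by exists u; rewrite hom_compE uE.
Qed.

Section Approximated.
Variables (F : seq {classic vertex Q}) (C X : rep k Q) (pi : rep_hom C X).
Variable rho : forall x, 'Hom(X x, C x).
Hypothesis pi_rho : approximation F pi rho.

Lemma approximation_inv_nat x y (al : arrow x y) m :
    (x : {classic vertex Q}) \in F -> (y : {classic vertex Q}) \in F ->
  rho y (rep_act X al m) = rep_act C al (rho x m).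
Proof.
have [piK rhoK _] := pi_rho => xF yF; apply: (can_inj (piK y yF)).
by rewrite hom_natE !rhoK.
Qed.

(** A right inverse [s] of [pi] is two-sided: [s pi] agrees with the identity on [F], which
    generates [C]. Hence [X] is isomorphic to [C]. *)
Lemma approximation_retract (fQ : interval_finite Q) :
  rep_plus fQ C -> retraction pi -> rep_plus fQ X.
Proof.
have [piK rhoK gen] := pi_rho => Cp [s ps]; apply: (rep_plus_iso Cp ps).
apply: gen => x u xF.
rewrite hom_compE -[in LHS](piK x xF (s x _)) -hom_compE ps /=.
by rewrite !id_lfunE piK.
Qed.

End Approximated.

Definition neighborhood (F : seq {classic vertex Q}) (S : set (vertex Q)) :=
  forall x, S x -> [/\ (x : {classic vertex Q}) \in F,
    forall y, arrow x y -> (y : {classic vertex Q}) \in F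
  & forall y, arrow y x -> (y : {classic vertex Q}) \in F].

Lemma convex_neighborhood (hQ : strongly_locally_finite Q) S : finite_set S ->
  exists F, convex F /\ neighborhood F S.
Proof.
move=> fS; pose T := S `|` \bigcup_(x in S)
  ((fun b : {y & arrow x y} => tag b) @` setT `|`
   (fun b : {y & arrow y x} => tag b) @` setT).
have fT : finite_set T.
  rewrite finite_setU; split=> //; apply: bigcup_finite => // x _.
  by rewrite finite_setU; split; apply: finite_image; case: (hQ.1 x).
have [F [cF TF]] := convex_hull hQ.2 fT.
exists F; split=> // x Sx; split=> [|y al|y al]; apply: TF; first by left.
  by right; exists x => //; left; exists (existT _ y al).
by right; exists x => //; right; exists (existT _ y al).
Qed.

Section FiniteSupport.
Variables (F : seq {classic vertex Q}) (S : set (vertex Q)).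
Hypothesis nbF : neighborhood F S.
Variable L : rep k Q.
Hypothesis supL : supported_in S L.

(** The lift is [rho u]: [L] vanishes off [S], and arrows leaving [S] end in [F], where [rho] is
    natural. *)
Lemma lift_to_approximation C Z (pi : rep_hom C Z) rho (u : rep_hom L Z) :
  approximation F pi rho -> exists u' : rep_hom L C, hom_comp pi u' = u.
Proof.
move=> ap; have [piK rhoK _] := ap.
have [u' u'E] : exists u' : rep_hom L C, forall x, u' x = (rho x \o u x)%VF.
  apply: rep_hom_of => x y al m; rewrite !comp_lfunE.
  have [Sx|nSx] := pselect (S x); last by rewrite (supL m nSx) !linear0.
  have [xF sx _] := nbF Sx; rewrite hom_natE (approximation_inv_nat ap) //.
  exact: sx.
exists u'; apply: rep_hom_ext => x m; rewrite hom_compE u'E comp_lfunE.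
have [Sx|nSx] := pselect (S x); last by rewrite (supL m nSx) !linear0.
by have [xF _ _] := nbF Sx; rewrite rhoK.
Qed.

(** Dually, [r rho] is a left inverse: only arrows ending in [S] matter, and they start in [F]. *)
Lemma section_descent C Z (pi : rep_hom C Z) rho (u : rep_hom L C) :
  approximation F pi rho -> section u -> section (hom_comp pi u).
Proof.
move=> ap [r ru]; have [piK rhoK _] := ap.
have [r' r'E] : exists r' : rep_hom Z L, forall x, r' x = (r x \o rho x)%VF.
  apply: rep_hom_of => x y al m; rewrite !comp_lfunE.
  have [Sy|nSy] := pselect (S y); last by rewrite [LHS]supL // [RHS]supL.
  have [yF _ py] := nbF Sy; rewrite (approximation_inv_nat ap) ?hom_natE //.
  exact: py al.
exists r'; apply: rep_hom_ext => x m; rewrite !hom_compE r'E comp_lfunE.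
have [Sx|nSx] := pselect (S x); last by rewrite (supL m nSx) !linear0.
by have [xF _ _] := nbF Sx; rewrite piK // -hom_compE ru.
Qed.

Lemma lift_descent M N (f : rep_hom L M) (g : rep_hom M N) C Z
    (pi : rep_hom C Z) rho (v : rep_hom Z N) (t : rep_hom C M) :
  short_exact f g -> approximation F pi rho -> hom_comp g t = hom_comp v pi ->
  exists t' : rep_hom Z M, hom_comp g t' = v.
Proof.
move=> fg ap gt; have [piK rhoK _] := ap.
have gtE x u : g x (t x u) = v x (pi x u) by rewrite -!hom_compE gt.
(* Off [S] the map [g] is bijective, so [v] lifts uniquely there. The uniqueness makes this lift
   agree with [t rho] on the rest of [F], so arrows ending in [S] cause no conflict. *)
pose h x : 'Hom(Z x, M x) :=
  if pselect (S x) then (t x \o rho x)%VF else ((g x)^-1 \o v x)%VF.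
have gh x m : g x (h x m) = v x m.
  rewrite /h; case: pselect => [Sx|nSx]; rewrite comp_lfunE.
    by have [xF _ _] := nbF Sx; rewrite gtE rhoK.
  by rewrite limg_lfunVK //; case: (fg x) => _ _ ->; rewrite memvf.
have g_inj x m : ~ S x -> g x m = 0 -> m = 0.
  move=> nSx /(short_exact_lift fg)[l ->]; by rewrite (supL l nSx) linear0.
have hF x m : (x : {classic vertex Q}) \in F -> h x m = t x (rho x m).
  move=> xF; rewrite /h; case: pselect => [Sx|nSx]; first by rewrite comp_lfunE.
  apply/eqP; rewrite -subr_eq0; apply/eqP/(g_inj x) => //.
  rewrite linearB /= gtE rhoK // comp_lfunE limg_lfunVK ?subrr //.
  by case: (fg x) => _ _ ->; rewrite memvf.
have [t' t'E] : exists t' : rep_hom Z M, forall x, t' x = h x.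
  apply: rep_hom_of => x y al m.
  have [Sy|nSy] := pselect (S y); last first.
    apply/eqP; rewrite -subr_eq0; apply/eqP/(g_inj y) => //.
    by rewrite linearB /= hom_natE !gh hom_natE subrr.
  have [yF _ py] := nbF Sy; have xF := py x al.
  by rewrite !hF // (approximation_inv_nat ap) // hom_natE.
by exists t'; apply: rep_hom_ext => x m; rewrite hom_compE t'E gh.
Qed.

End FiniteSupport.

(** The identity of [L] lifts to its approximation, which is therefore isomorphic to [L]. *)
Lemma rep_b_plus (hQ : strongly_locally_finite Q) L : rep_b L -> rep_plus hQ.2 L.
Proof.
move=> /rep_bP[S [fS supL]]; have [F [cF nbF]] := convex_neighborhood hQ fS.
have [C [pi [rho [Cp ap]]]] := approximation_exists hQ L cF.
have [s ps] := lift_to_approximation nbF supL (hom_id L) ap.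
by apply: (approximation_retract ap Cp); exists s.
Qed.

Lemma hom_id_comp X Y (u : rep_hom X Y) : hom_comp (hom_id Y) u = u.
Proof. by apply: rep_hom_ext => x m; rewrite hom_compE /= id_lfunE. Qed.

Lemma hom_compA X Y Z W (w : rep_hom Z W) (v : rep_hom Y Z) (u : rep_hom X Y) :
  hom_comp w (hom_comp v u) = hom_comp (hom_comp w v) u.
Proof. by apply: rep_hom_ext => x m; rewrite !hom_compE. Qed.

Lemma retraction_comp X Y Z (g : rep_hom Y Z) (f : rep_hom X Y) :
  retraction (hom_comp g f) -> retraction g.
Proof. by move=> [s E]; exists (hom_comp f s); rewrite hom_compA. Qed.

(** * Almost split sequences with finite dimensional left term *)

Section AlmostSplit.
Variables (hQ : strongly_locally_finite Q) (L M N : rep k Q).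
Variables (f : rep_hom L M) (g : rep_hom M N).
Hypotheses (fg : short_exact f g) (Lb : rep_b L).

(** A map from [L] to [Z] lifts to the approximation of [Z]; were the lift a section, the map would
    be one too. *)
Lemma left_almost_split_all :
  left_almost_split (rep_plus hQ.2) f -> left_almost_split rep_all f.
Proof.
move=> [nf las]; split=> // Z u _ nu.
have /rep_bP[S [fS supL]] := Lb; have [F [cF nbF]] := convex_neighborhood hQ fS.
have [C [pi [rho [Cp ap]]]] := approximation_exists hQ Z cF.
have [u' pu'] := lift_to_approximation nbF supL u ap.
have [h hf] : exists h, hom_comp h f = u'.
  apply: las => // su'; apply: nu; rewrite -pu'.
  exact: (section_descent nbF supL ap).
by exists (hom_comp pi h); rewrite -hom_compA hf.
Qed.

(** The composite [v pi] is tested instead of [v], and its lift to [M] descends to [Z]. *)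
Lemma right_almost_split_all :
  right_almost_split (rep_plus hQ.2) g -> right_almost_split rep_all g.
Proof.
move=> [ng ras]; split=> // Z v _ nv.
have /rep_bP[S [fS supL]] := Lb; have [F [cF nbF]] := convex_neighborhood hQ fS.
have [C [pi [rho [Cp ap]]]] := approximation_exists hQ Z cF.
have [t gt] : exists t, hom_comp g t = hom_comp v pi.
  by apply: ras => // /retraction_comp.
exact: (lift_descent nbF supL fg ap gt).
Qed.

(** If [pi] were not a retraction it would lift to [M]; by descent so would the identity of [N],
    splitting [g]. *)
Lemma right_end_rep_plus : right_almost_split rep_all g -> rep_plus hQ.2 N.
Proof.
move=> [ng ras].
have /rep_bP[S [fS supL]] := Lb; have [F [cF nbF]] := convex_neighborhood hQ fS.
have [C [pi [rho [Cp ap]]]] := approximation_exists hQ N cF.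
apply: (approximation_retract ap Cp); apply: contrapT => npi.
have [t gt] := ras C pi I npi.
by apply: ng; apply: (lift_descent nbF supL fg ap); rewrite hom_id_comp; exact: gt.
Qed.

(** The lift of [f] to [C] factors as [h f], so [pi h f = f]; left minimality makes [pi h] an
    automorphism and [pi] a retraction. *)
Lemma middle_rep_plus : min_left_almost_split rep_all f -> rep_plus hQ.2 M.
Proof.
move=> [lm [nf las]].
have /rep_bP[S [fS supL]] := Lb; have [F [cF nbF]] := convex_neighborhood hQ fS.
have [C [pi [rho [Cp ap]]]] := approximation_exists hQ M cF.
have [f' pf'] := lift_to_approximation nbF supL f ap.
have [h hf] : exists h, hom_comp h f = f'.
  apply: las => // sf'; apply: nf; rewrite -pf'.
  exact: (section_descent nbF supL ap).
apply: (approximation_retract ap Cp).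
have [|a [ha _]] := lm (hom_comp pi h); first by rewrite -hom_compA hf.
by exists (hom_comp h a); rewrite hom_compA.
Qed.

End AlmostSplit.

(** Setting [L] to zero off [G] gives a quotient because no arrow carries a nonzero vector from
    outside [G] into [G]. *)
Lemma truncation (G : set (vertex Q)) L :
    (forall x y, arrow x y -> G y -> ~ G x -> forall u : L x, u = 0) ->
  exists T (q : rep_hom L T), [/\ supported_in G T,
    forall x, G x -> injective (q x) & forall x, limg (q x) = fullv].
Proof.
move=> LG; pose U x : {vspace L x} := if pselect (G x) then fullv else 0%VS.
pose T x : vectType k := subvs_of (U x).
pose q x : 'Hom(L x, T x) := linfun (vsproj (U x)).
pose i x : 'Hom(T x, L x) := linfun (@vsval k (L x) (U x)).
pose R : rep k Q := Rep (fun x y al => (q y \o (rep_act L al \o i x))%VF).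
have UT x : G x -> U x = fullv by move=> Gx; rewrite /U; case: pselect.
have RG : supported_in G R.
  move=> x u nGx; have U0 : U x = 0%VS by rewrite /U; case: pselect.
  by apply/val_inj/eqP; rewrite /= -memv0 -U0; exact: (subvsP (u : T x)).
have iq x u : G x -> i x (q x u) = u.
  by move=> Gx; rewrite !lfunE /= vsprojK // UT ?memvf.
have [h hE] : exists h : rep_hom L R, forall x, h x = q x.
  apply: rep_hom_of => x y al u; rewrite [RHS]comp_lfunE comp_lfunE.
  have [Gy|nGy] := pselect (G y); last by rewrite [LHS]RG // [RHS]RG.
  have [Gx|nGx] := pselect (G x); first by rewrite iq.
  by rewrite (LG x y al Gy nGx u) !linear0.
exists R, h; split=> [//|x Gx|x]; rewrite hE.
  by apply: (can_inj (g := i x)) => u; exact: iq.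
by apply/limg_fullP => u; exists (i x u); rewrite !lfunE /= vsvalK.
Qed.

(* Between the generators of [L] and those of the relations of [N] there are
   only finitely many vertices, and [L] turns out to be supported there:
   otherwise the projection [q] of [L] onto its restriction to these vertices
   would factor through [f], whereas [Ext^1(N, -)] vanishes on the kernel of
   [q], so that the sequence would split. *)
Lemma left_end_rep_b (hQ : strongly_locally_finite Q) L M N (f : rep_hom L M)
    (g : rep_hom M N) : short_exact f g -> rep_plus hQ.2 L -> rep_plus hQ.2 N ->
  left_almost_split (rep_plus hQ.2) f -> ~ retraction g -> rep_b L.
Proof.
move=> fg [s1L [s0L [dL [eL exL]]]] [s1 [s0 [d [e ex]]]] [_ las] ng.
have [ioL frL] := proj_sum_free k hQ.2 s0L.
have [io1 fr1] := proj_sum_free k hQ.2 s1.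
have [io0 fr0] := proj_sum_free k hQ.2 s0.
pose G := between (range (tnth (in_tuple s0L))) (range (tnth (in_tuple s1))).
have fG : finite_set G.
  by apply: (finite_between hQ.2); apply: finite_image; exact: finite_finset.
have L0 x : ~ (exists a, range (tnth (in_tuple s0L)) a /\ inhabited (qpath a x)) ->
    forall u : L x, u = 0.
  move=> nx u; have [xi <-] := short_exact_surj exL u.
  suff -> : xi = 0 by rewrite linear0.
  apply: (free_on_support frL) => j _ p; apply: nx.
  by exists (tnth (in_tuple s0L) j); split; [exists j | exists].
have [x y al Gy nGx u|T [q [GT q_inj q_surj]]] := @truncation G L.
  (* A path from a generator of [L] to [x] would continue through [y] to a generator of the
     relations of [N] and place [x] in [G]. *)
  apply: L0 => -[a [Ia [p]]]; apply: nGx.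
  have [a' [b [_ Ib [[_ r]]]]] := Gy.
  by exists a, b; split=> //; exists; exact: (p, qcat (qrcons (qnil x) al) r).
have Tb : rep_b T by apply/rep_bP; exists G.
have [[r rq]|nq] := pselect (section q).
  apply/rep_bP; exists G; split=> // x u nGx.
  have := hom_compE r q u; rewrite rq /= id_lfunE => ->.
  by rewrite (GT x (q x u) nGx) linear0.
have [r rf] := las T q (rep_b_plus hQ Tb) nq.
exfalso; apply: ng.
(* A linear right inverse of [g] at each vertex, not claimed to be natural, corrected by an element
   of the image of [f] so that [r] kills it. *)
pose s x : 'Hom(N x, M x) :=
  (g x)^-1%VF - (f x \o ((q x)^-1 \o (r x \o (g x)^-1)))%VF.
have gK x u : g x ((g x)^-1%VF u) = u.
  by rewrite limg_lfunVK //; case: (fg x) => _ _ ->; rewrite memvf.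
have qK x u : q x ((q x)^-1%VF u) = u by rewrite limg_lfunVK // q_surj memvf.
have sE x u : s x u = (g x)^-1%VF u - f x ((q x)^-1%VF (r x ((g x)^-1%VF u))).
  by rewrite lfunE /= opp_lfunE !comp_lfunE.
have gs x u : g x (s x u) = u.
  by rewrite sE linearB /= gK (short_exact_comp fg) subr0.
have rs x u : r x (s x u) = 0.
  by rewrite sE linearB /= -[r x (f x _)]hom_compE rf qK subrr.
have [e' e'E] := free_on_hom fr0 (Y := M) (fun j => s _ \o (e _ \o io0 j))%VF.
have ge' : hom_comp g e' = e.
  apply: (free_on_hom_ext fr0) => j m jj.
  by rewrite hom_compE e'E // comp_lfunE gs comp_lfunE.
have re' : forall x u, r x (e' x u) = 0.
  move=> x u; rewrite -hom_compE; apply: (free_on_hom0 fr0) => j m jj.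
  by rewrite hom_compE e'E // comp_lfunE rs.
(* On a generator of the relations this value is [f l] with [q l = r (f l) = 0]. Its vertex lies in
   [G], where [q] is injective, or is reached by no generator of [L]; so [l = 0]. *)
have e'd : forall x u, e' x (d x u) = 0.
  move=> x u; rewrite -hom_compE; apply: (free_on_hom0 fr1) => j m _.
  rewrite hom_compE; set z := e' _ _.
  have gz : g _ z = 0 by rewrite -hom_compE ge' (short_exact_comp ex).
  have [l zl] := short_exact_lift fg gz.
  suff l0 : l = 0 by rewrite zl l0 linear0.
  have [[a [Ia [p]]]|na] := pselect (exists a,
      range (tnth (in_tuple s0L)) a /\ inhabited (qpath a (tnth (in_tuple s1) j))).
    apply: q_inj; last by rewrite linear0 -rf hom_compE -zl re'.
    by exists a, (tnth (in_tuple s1) j); split=> //; exact: (inhabits (p, qnil _)).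
  exact: L0.
(* Killing the relations, [e'] descends to [N]; the induced map is a right inverse of [g]. *)
have [t te] : exists t : rep_hom N M, hom_comp t e = e'.
  apply: factor_epi => x; first by case: (ex x).
  by move=> u /(short_exact_lift ex)[w ->]; exact: e'd.
exists t; apply: rep_hom_ext => x u; have [w <-] := short_exact_surj ex u.
by rewrite hom_compE -(hom_compE t e) te -(hom_compE g e') ge' /= id_lfunE.
Qed.
End Descent.

Theorem proposition3p6 (Q : quiver) (hQ : strongly_locally_finite Q)
    (k : fieldType) (L M N : rep k Q) (f : rep_hom L M) (g : rep_hom M N)
    (hfg : short_exact f g) :
  almost_split_sequence (rep_plus (proj2 hQ)) f g <->
  almost_split_sequence rep_all f g /\ rep_b L.
Proof.
split=> [[[Lp Mp Np] [_ [lm las] [rm ras]]]|[[_ [_ [lm las] [rm ras]]] Lb]].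
  have Lb : rep_b L by exact: left_end_rep_b hfg Lp Np las ras.1.
  split=> //; split=> //; split=> //; split=> //.
    exact: left_almost_split_all Lb las.
  exact: right_almost_split_all hfg Lb ras.
have Lp := rep_b_plus hQ Lb.
have Mp : rep_plus (proj2 hQ) M by exact: (middle_rep_plus hQ Lb (conj lm las)).
have Np : rep_plus (proj2 hQ) N by exact: (right_end_rep_plus hQ hfg Lb ras).
(* With all three terms in [rep_plus], minimality is unchanged and the factorization properties are
   merely restricted to fewer test objects. *)
split=> //; split=> //; split=> //.
  by split=> [|Z u _]; [exact: las.1 | exact: las.2].
by split=> [|Z v _]; [exact: ras.1 | exact: ras.2].
Qed.
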